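(* There is no finite group $G$ with $|2\text{-}Cent(G)| = 4$; that is, there is no $(2,4)$-centralizer group.
   Context: All groups are finite. For a group $G$, $2\text{-}Cent(G) = \{ C_G(\{x,y\}) \mid x,y\in G,\ x\neq y\}$, where $C_G(\{x,y\}) = C_G(x)\cap C_G(y)$ is the centralizer of the subset $\{x,y\}$ in $G$. A group $G$ is called $(2,n)$-centralizer if $|2\text{-}Cent(G)| = n$. *)

(* Defs.v *)
From HB Require Import structures.
From mathcomp Require Import all_boot all_fingroup.

Set Implicit Arguments.
Unset Strict Implicit.
Unset Printing Implicit Defensive.

Local Open Scope group_scope.

(* Since the points are distinct, G itself is listed only when the center of
   G is nontrivial, and the trivial group has no 2-element centralizer. *)
Definition two_cent (gT : finGroupType) (G : {group gT}) : {set {set gT}} :=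
  [set 'C_G([set x; y]) | x in G, y in G & x != y].

Definition two_centralizer (gT : finGroupType) (G : {group gT}) (n : nat) :
  Prop := #|two_cent G| = n.

(* Main.v *)
(** [two_cent G] contains every ['C_G[x]] with [x != 1] and all intersections of
two of these.  Choosing noncentral elements [x], [y], [z] greedily with maximal
centralizers, and using that a group is not the union of two proper subgroups,
one gets three pairwise incomparable centralizers [A], [B], [C].  If there are
only four members, the fourth one is [D = A :&: B = A :&: C = B :&: C], so
[G = A :|: B :|: C].  A nontrivial element of [D] is centralized by [y] and [z],
but no member of the family contains both, hence [D] is trivial.  A union of
three proper subgroups with trivial pairwise intersections is abelian, a
contradiction.
*)
Require Import Defs.
From mathcomp Require Import all_boot all_fingroup.

Set Implicit Arguments.
Unset Strict Implicit.
Unset Printing Implicit Defensive.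

Local Open Scope group_scope.

Section TwoCent.

Variables (gT : finGroupType) (G : {group gT}).

(** If [b] in [G] avoids [A] and [a] in [G] avoids [B], then [a] is in [A] and [b] in [B], so
    [a * b] avoids both. *)
Lemma sub_groupU (A B : {group gT}) :
  (G \subset A :|: B) = (G \subset A) || (G \subset B).
Proof.
apply/idP/orP=> [sGAB | [] sG]; last 2 first.
- exact: subset_trans sG (subsetUl A B).
- exact: subset_trans sG (subsetUr A B).
case: (boolP (G \subset A)) => [|/subsetPn[b Gb A'b]]; first by left.
right; apply/subsetP=> a Ga; apply: contraR A'b => B'a.
have Aa: a \in A by move/subsetP/(_ a Ga): sGAB; rewrite inE (negPf B'a) orbF.
case: (boolP (b \in A)) => // A'b.
have Bb: b \in B by move/subsetP/(_ b Gb): sGAB; rewrite inE (negPf A'b).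
by move/subsetP/(_ _ (groupM Ga Gb)): sGAB; rewrite inE groupMl // groupMr //
  (negPf A'b) (negPf B'a).
Qed.

(** The pair [x], [1] has the same centralizer as [x] alone. *)
Lemma cent1_in_two_cent x : x \in G -> x != 1 -> 'C_G[x] \in two_cent G.
Proof.
move=> Gx ntx; apply/imset2P; exists x 1; rewrite ?inE ?group1 //.
by rewrite centU !cent_set1 cent11T setIT.
Qed.

Lemma cent1I_in_two_cent x y : x \in G -> y \in G -> x != 1 ->
  'C_G[x] :&: 'C_G[y] \in two_cent G.
Proof.
move=> Gx Gy ntx; have [<-|neq_xy] := eqVneq x y.
  by rewrite setIid cent1_in_two_cent.
apply/imset2P; exists x y; rewrite ?inE ?Gy //.
by rewrite centU !cent_set1 setIACA setIid.
Qed.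

Lemma card_two_cent_abelian : abelian G -> #|two_cent G| <= 1.
Proof.
move=> cGG; rewrite -(cards1 (G : {set gT})); apply/subset_leq_card/subsetP.
move=> _ /imset2P[x y Gx + ->]; rewrite !inE => /andP[Gy _].
apply/eqP/setIidPl; apply: subset_trans cGG (centS _).
by rewrite subUset !sub1set Gx.
Qed.

Lemma cent1_self x : x \in G -> x \in 'C_G[x].
Proof. by move=> Gx; rewrite inE Gx cent1id. Qed.

Lemma notin_subcent1_neq1 x y :
  x \in G -> y \in G -> y \notin 'C_G[x] -> x != 1.
Proof.
by move=> Gx Gy; apply: contraNneq => ->; rewrite cent11T inE Gy inE.
Qed.

(** The three reverse non-inclusions are left implicit: they follow from the middle clause, since
    each element lies in its own centralizer. *)
Lemma incomparable_subcent1 : ~~ abelian G -> exists t : gT * gT * gT,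
  let: (x, y, z) := t in
  [/\ [/\ x \in G, y \in G & z \in G],
      [/\ y \notin 'C_G[x], z \notin 'C_G[x] & z \notin 'C_G[y]]
    & [/\ ~~ ('C_G[x] \subset 'C_G[y]), ~~ ('C_G[x] \subset 'C_G[z])
        & ~~ ('C_G[y] \subset 'C_G[z])]].
Proof.
case/subsetPn=> x0 Gx0 C'x0.
have Px0: x0 \in G :\: 'C(G) by rewrite in_setD Gx0 C'x0.
case: (@arg_maxnP _ x0 (mem (G :\: 'C(G))) (fun u => #|'C_G[u]|) Px0).
move=> x /setDP[Gx C'x] maxx.
(* This makes [y] and [z] noncentral, hence subject to the maximality of [x]. *)
have outZ u v : v \in G -> u \in G -> u \notin 'C_G[v] -> u \in G :\: 'C(G).
  move=> Gv Gu; rewrite in_setD Gu andbT => v'u; apply: contra v'u.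
  by move/centP=> cu; rewrite inE Gu; apply/cent1P/cu.
have /subsetPn[y0 Gy0 A'y0]: ~~ (G \subset 'C_G[x]).
  by apply: contra C'x; rewrite subsetI subxx sub_cent1.
have Py0: y0 \in G :\: 'C_G[x] by rewrite in_setD A'y0.
case: (@arg_maxnP _ y0 (mem (G :\: 'C_G[x])) (fun u => #|'C_G[u]|) Py0).
move=> y /setDP[Gy A'y] maxy.
have /subsetPn[z Gz]: ~~ (G \subset 'C_G[x] :|: 'C_G[y]).
  rewrite sub_groupU negb_or; apply/andP; split; apply/subsetPn.
    by exists y.
  by exists x => //; apply: contra A'y; rewrite !in_setI Gx Gy cent1C.
rewrite in_setU negb_or => /andP[A'z B'z].
exists (x, y, z); split=> //.
have nsub u v : v \in G -> v \notin 'C_G[u] -> #|'C_G[v]| <= #|'C_G[u]| ->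
    ~~ ('C_G[u] \subset 'C_G[v]).
  move=> Gv u'v le_vu; apply: contra u'v => sub_uv.
  have /eqP->: 'C_G[u] == 'C_G[v] by rewrite eqEcard sub_uv.
  exact: cent1_self.
split; apply: nsub => //.
- exact/maxx/(outZ y x).
- exact/maxx/(outZ z x).
- exact/maxy/setDP.
Qed.

(* For [c, c'] in [C] and [x] in [A], [c * x] and [c' * x] both lie in [B], so
   [c = c']; this is applied to [c = x * y] and [c' = y * x]. *)
Lemma commute_cover3 (A B C : {group gT}) x y :
    G \subset A :|: B :|: C ->
    A :&: B = 1 -> A :&: C = 1 -> B :&: C = 1 ->
  x \in G -> y \in G -> x \in A -> y \in B -> commute x y.
Proof.
move=> /subsetP sG tiAB tiAC tiBC Gx Gy Ax By.
have [->|ntx] := eqVneq x 1; first exact/commute_sym/commute1.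
have [->|nty] := eqVneq y 1; first exact: commute1.
have nmem (X Y : {group gT}) u : X :&: Y = 1 -> u != 1 -> u \in X -> u \notin Y.
  move=> tiXY ntu Xu; apply: contra ntu => Yu.
  by rewrite -in_set1 -[[set 1]]tiXY inE Xu.
have B'x := nmem _ _ _ tiAB ntx Ax; have C'x := nmem _ _ _ tiAC ntx Ax.
have A'y: y \notin A by apply: nmem nty By; rewrite setIC.
have inC u : u \in G -> u \notin A -> u \notin B -> u \in C.
  by move=> Gu A'u B'u; move: (sG u Gu); rewrite !inE (negPf A'u) (negPf B'u).
have inB u : u \in G -> u \notin A -> u \notin C -> u \in B.
  move=> Gu A'u C'u; move: (sG u Gu).
  by rewrite !inE (negPf A'u) (negPf C'u) orbF.
have [Gxy Gyx] := (groupM Gx Gy, groupM Gy Gx).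
have Cxy: x * y \in C by apply: inC; rewrite // ?(groupMl _ Ax, groupMr _ By).
have Cyx: y * x \in C by apply: inC; rewrite // ?(groupMr _ Ax, groupMl _ By).
have Bxyx: x * y * x \in B.
  apply: inB; first exact: groupM.
    by rewrite (groupMr _ Ax) (groupMl _ Ax).
  by rewrite (groupMl _ Cxy).
have Byxx: y * x * x \in B.
  by apply: inB; rewrite ?(groupM Gyx Gx, groupMr _ Ax, groupMl _ Cyx).
(* The quotient of [x * y * x] by [y * x * x] is [x * y * (y * x)^-1], which therefore lies in both
   [B] and [C]. *)
apply/eqP; rewrite eq_mulgV1 -in_set1 -[[set 1]]tiBC inE.
rewrite (groupM Cxy (groupVr Cyx)) andbT.
by have := groupM Bxyx (groupVr Byxx); rewrite invMg mulgA mulgK.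
Qed.

Lemma card_two_cent_neq4 : #|two_cent G| != 4.
Proof.
apply/eqP=> F4; have nabG: ~~ abelian G.
  by apply/negP=> /card_two_cent_abelian; rewrite F4.
have [[[x y] z] [[Gx Gy Gz] [A'y A'z B'z] [nAB nAC nBC]]] :=
  incomparable_subcent1 nabG.
have ntx := notin_subcent1_neq1 Gx Gy A'y.
have nty := notin_subcent1_neq1 Gy Gz B'z.
have ntz: z != 1 by apply: contraNneq A'z => ->; rewrite group1.
have FA := cent1_in_two_cent Gx ntx; have FB := cent1_in_two_cent Gy nty.
have FC := cent1_in_two_cent Gz ntz.
have FAB := cent1I_in_two_cent Gx Gy ntx.
have FAC := cent1I_in_two_cent Gx Gz ntx.
have FBC := cent1I_in_two_cent Gy Gz nty.
have Ax := cent1_self Gx; have By := cent1_self Gy; have Cz := cent1_self Gz.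
set A := 'C_G[x] in A'y A'z nAB nAC FA FAB FAC Ax.
set B := 'C_G[y] in B'z nAB nBC FB FAB FBC By.
set C := 'C_G[z] in nAC nBC FC FAC FBC Cz.
have nBA: ~~ (B \subset A) by apply/subsetPn; exists y.
have nCA: ~~ (C \subset A) by apply/subsetPn; exists z.
have nCB: ~~ (C \subset B) by apply/subsetPn; exists z.
have neq_nsub (X Y : {set gT}) : ~~ (X \subset Y) -> (X == Y) = false.
  by move=> nXY; apply: contraNF nXY => /eqP->.
(* Four distinct members exhaust a family of size four. *)
have memF X : X \in two_cent G -> [\/ X = A, X = B, X = C | X = A :&: B].
  have Us: uniq [:: A; B; C; A :&: B].
    rewrite /= !inE !neq_nsub // subsetI negb_and.
    - by rewrite nCA.
    - by rewrite nBA.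
    by rewrite nAB orbT.
  have sF: {subset [:: A; B; C; A :&: B] <= enum (two_cent G)}.
    by move=> Y; rewrite mem_enum !inE => /or4P[]/eqP->.
  have [|_ eqF] := uniq_min_size Us sF; first by rewrite -cardE F4.
  rewrite -mem_enum -eqF !inE => /or4P[]/eqP->;
    by [constructor 1 | constructor 2 | constructor 3 | constructor 4].
(* Equality of [A :&: C] with [A], [B] or [C] would put [A] inside [C], [B] inside [A] or [C] inside
   [A]. *)
have eqAC: A :&: C = A :&: B.
  by case: (memF _ FAC) => // /eqP; rewrite eq_sym neq_nsub // subsetI
    negb_and ?nAC ?nBA ?nCA ?orbT.
have eqBC: B :&: C = A :&: B.
  by case: (memF _ FBC) => // /eqP; rewrite eq_sym neq_nsub // subsetI
    negb_and ?nAB ?nBC ?nCB ?orbT.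
have coverG: G \subset A :|: B :|: C.
  apply/subsetP=> u Gu; rewrite !in_setU.
  have [->|ntu] := eqVneq u 1; first by rewrite group1.
  have := cent1_self Gu; case: (memF _ (cent1_in_two_cent Gu ntu)) => ->;
    by [move=> -> | move=> ->; rewrite orbT | case/setIP=> ->].
have tiAB: A :&: B = 1.
  apply/trivgP/subsetP=> d Dd; rewrite inE; apply: contraT => ntd.
  have [Ad Bd] := setIP Dd.
  have Cd: d \in C by have: d \in A :&: C; [rewrite eqAC | case/setIP].
  have Gd: d \in G by case/setIP: Ad.
  have cd (u : gT) : u \in G -> d \in 'C_G[u] -> u \in 'C_G[d].
    by move=> Gu; rewrite !in_setI Gu Gd cent1C.
  have cyd := cd y Gy Bd; have czd := cd z Gz Cd.
  (* [A] misses [y], while [B] and [A :&: B] miss [z]; [C] misses [y] because [B :&: C] is contained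
     in [A]. *)
  case: (memF _ (cent1_in_two_cent Gd ntd)) => eqCd; rewrite eqCd in cyd czd.
  - by rewrite cyd in A'y.
  - by rewrite czd in B'z.
  - suffices: y \in A :&: B by rewrite inE (negPf A'y).
    by rewrite -eqBC inE By.
  by rewrite inE (negPf A'z) in czd.
(* It suffices that [x] and [y] commute, against the choice of [y] outside [A]. *)
case/negP: A'y; rewrite inE Gy; apply/cent1P/commute_sym.
rewrite tiAB in eqAC eqBC.
exact: (@commute_cover3 'C_G[x] 'C_G[y] 'C_G[z]).
Qed.

End TwoCent.

Theorem theorem4p1 :
  ~ (exists (gT : finGroupType) (G : {group gT}), two_centralizer G 4).
Proof. by case=> gT [G] /eqP; apply/negP/card_two_cent_neq4. Qed.
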